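(* Let $A$ be a torsion-free abelian group, $(A,(\cdot,\cdot),R)$ a tame irreducible affine reflection system of type $A_1$, with Weyl group $\mathcal{W}$ and hyperbolic Weyl group $\widetilde{\mathcal{W}}$. Let $\Pi$ be a reflectable set for $R$ and assume that the center $Z(\widetilde{\mathcal{W}})$ is a free abelian group. Fix a free basis $\{z_\ell\}_{\ell\in L}$ of $Z(\widetilde{\mathcal{W}})$, and for each $\ell\in L$ let $f^\ell=(\alpha_1^\ell,\ldots,\alpha_{k_\ell}^\ell)$ be a fixed element of $\mathrm{Alt}(\Pi)$ such that $z_\ell=f^\ell_{\widetilde{\mathcal{W}}}=w_{\alpha^\ell_1}\cdots w_{\alpha^\ell_{k_\ell}}$ in $\widetilde{\mathcal{W}}$. Then the following statements are equivalent: (i) The assignment $w_\alpha\mapsto x_\alpha$, $\alpha\in\Pi$, induces an isomorphism $\psi$ from $\mathcal{W}$ onto the group $G$ presented by generators $x_\alpha$ ($\alpha\in\Pi$) and relations $x_\alpha^2=1$ ($\alpha\in\Pi$), $f^\ell_G=1$ ($\ell\in L$). (ii) The assignment $w_\alpha\mapsto\widetilde{x}_\alpha$, $\alpha\in\Pi$, induces an isomorphism $\theta$ from $\widetilde{\mathcal{W}}$ onto the group $\widetilde{G}$ presented by generators $\widetilde{x}_\alpha$ ($\alpha\in\Pi$) and relations $\widetilde{x}_\alpha^2=1$ ($\alpha\in\Pi$), $[\widetilde{x}_\alpha,f^\ell_{\widetilde{G}}]=1$ ($\alpha\in\Pi$, $\ell\in L$).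
   Context: Notation: for a group $H$ with a fixed family $\{h_\alpha\mid\alpha\in P\}\subseteq H$ and a $k$-tuple $f=(\alpha_1,\dots,\alpha_k)$ in $P$, put $f_H=h_{\alpha_1}\cdots h_{\alpha_k}$ (used with $h_\alpha=w_\alpha$, $x_\alpha$, $\widetilde{x}_\alpha$ in $\widetilde{\mathcal{W}}$, $G$, $\widetilde{G}$ respectively). $[x,y]=xyx^{-1}y^{-1}$. Let $A$ be a torsion-free abelian group with a nontrivial symmetric positive semidefinite bi-homomorphism $(\cdot,\cdot):A\times A\to\mathbb{Q}$, with radical $A^0=\{\alpha\in A:(\alpha,A)=0\}$. For $B\subseteq A$ put $B^\times=B\setminus A^0$, $B^0=B\cap A^0$. Put $(\beta,\alpha^\vee)=2(\beta,\alpha)/(\alpha,\alpha)$ if $(\alpha,\alpha)\neq0$ and $(\beta,\alpha^\vee)=0$ otherwise. A subset $R\subseteq A$ is an affine reflection system if (R1) $R=-R$; (R2) $R$ generates $A$; (R3) for $\alpha\in R^\times$, $\beta\in R$ there are $d,u\in\mathbb{Z}_{\ge0}$ with $(\beta+\mathbb{Z}\alpha)\cap R=\{\beta-d\alpha,\dots,\beta+u\alpha\}$ and $d-u=(\beta,\alpha^\vee)$. It is irreducible if $R^\times$ is not a disjoint union of two nonempty orthogonal subsets, and tame if $R^0\subseteq R^\times-R^\times$. Its type is the type of its image in $A/A^0$ (a locally finite root system); type $A_1$ means that this image is $\{0,\pm\bar\epsilon\}$. For $R$ tame irreducible of type $A_1$ it is known that $R=(S+S)\cup(\dot R+S)$ with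 $\dot R=\{0,\pm\epsilon\}$, $S\subseteq R^0$, $0\in S$, $S\pm2S\subseteq S$, $\langle S\rangle=A^0$, and $A=\mathbb{Z}\epsilon\oplus A^0$. Fix such $\epsilon$, $S$, normalized so that $(\epsilon,\epsilon)=2$. For $\alpha\in A$ write $\alpha=\mathrm{sgn}(\alpha)\epsilon+p(\alpha)$ with $\mathrm{sgn}(\alpha)\in\mathbb{Z}$, $p(\alpha)\in A^0$. The Weyl group $\mathcal{W}$ of $R$ is the subgroup of $\mathrm{Aut}(A)$ generated by all $w_\alpha(\beta)=\beta-(\beta,\alpha^\vee)\alpha$, $\alpha\in R$; for $P\subseteq R$, $\mathcal{W}_P$ is the subgroup generated by $w_\alpha$, $\alpha\in P$. A set $P\subseteq R^\times$ is a reflectable set if $\mathcal{W}_PP=R^\times$. $\mathrm{Alt}(P)$ is the set of all tuples $(\alpha_1,\dots,\alpha_k)$ of elements of $P$ (all $k$) with $k$ even and $\sum_{j=1}^k(-1)^j\mathrm{sgn}(\alpha_j)p(\alpha_j)=0$. Let $\mathcal{V}=\mathbb{Q}\otimes_{\mathbb{Z}}A$ with the extended form; identify $A$, $R$ with subsets of $\mathcal{V}$. Let $\mathcal{V}^0=\mathbb{Q}\otimes A^0$, so $\mathcal{V}=\mathbb{Q}\epsilon\oplus\mathcal{V}^0$. Fix a basis $\{\sigma_j\mid j\in J\}\subseteq S$ of $\mathcal{V}^0$; let $\lambda_j\in(\mathcal{V}^0)^\star$ be given by $\lambda_j(\sigma_i)=\delta_{ij}$, and $(\mathcal{V}^0)^\dagger=\sum_{j\in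 J}\mathbb{Q}\lambda_j$. Put $\widetilde{\mathcal{V}}=\mathcal{V}\oplus(\mathcal{V}^0)^\dagger$ and extend the form to a symmetric bilinear form on $\widetilde{\mathcal V}$ by $(\epsilon,(\mathcal{V}^0)^\dagger)=((\mathcal{V}^0)^\dagger,(\mathcal{V}^0)^\dagger)=0$ and $(\sigma,\lambda)=\lambda(\sigma)$ for $\sigma\in\mathcal{V}^0$, $\lambda\in(\mathcal{V}^0)^\dagger$. For $\alpha\in\mathcal{V}$ let $w_\alpha\in\mathrm{Aut}(\widetilde{\mathcal{V}})$, $w_\alpha(\beta)=\beta-(\beta,\alpha^\vee)\alpha$ (same convention for $\alpha^\vee$). The hyperbolic Weyl group $\widetilde{\mathcal{W}}$ is the subgroup of $\mathrm{Aut}(\widetilde{\mathcal{V}})$ generated by $w_\alpha$, $\alpha\in R$. (It is known that $\{w_\alpha\mid\alpha\in\Pi\}$ generates $\mathcal{W}$ and $\widetilde{\mathcal{W}}$ for a reflectable set $\Pi$.) *)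

(* Defs.v *)
From HB Require Import structures.
From mathcomp Require Import all_boot all_order all_algebra.
From mathcomp Require Import all_classical.
From mathcomp Require Import ring lra zify.

Set Implicit Arguments.
Unset Strict Implicit.
Unset Printing Implicit Defensive.

Import Order.TTheory GRing.Theory Num.Theory.

Local Open Scope classical_set_scope.
Local Open Scope ring_scope.
Local Open Scope quotient_scope.

Section GeneratedSubgroup.
Variables (G : groupType) (X : set G).

Definition gen_pred : {pred G} := [pred g | `[< forall H : {pred G},
  group_closed H -> (forall x, X x -> x \in H) -> g \in H >]].

Record gen_group := GenGroup {gen_val :> G; gen_valP : gen_val \in gen_pred}.

HB.instance Definition _ := [isSub for gen_val].
HB.instance Definition _ := [Choice of gen_group by <:].

Lemma gen_pred_closed : group_closed gen_pred.
Proof.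
split=> [|x y /asboolP hx /asboolP hy]; apply/asboolP => H hH XH.
  by have [] := hH.
by have [_ ->] := hH; rewrite ?hx ?hy.
Qed.

HB.instance Definition _ :=
  SubChoice_isSubGroup.Build G gen_pred gen_group gen_pred_closed.

Lemma mem_gen x : X x -> x \in gen_pred.
Proof. by move=> Xx; apply/asboolP => H _; apply. Qed.

End GeneratedSubgroup.

Definition center (G : groupType) : set G := [set z | forall g, commute z g].

Definition zexpg (G : groupType) (g : G) (n : int) : G :=
  match n with Posz k => (g ^+ k)%g | Negz k => (g ^- k.+1)%g end.

Record free_abelian_basis (G : groupType) (Z : set G) (L : choiceType)
    (z : L -> G) : Prop := {
  fab_abelian : forall g h, Z g -> Z h -> commute g h;
  fab_mem : forall l, Z (z l);
  fab_span : forall g, Z g -> exists (s : seq L) (n : L -> int),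
    g = (\prod_(l <- s) zexpg (z l) (n l))%g;
  fab_free : forall (s : seq L) (n : L -> int), uniq s ->
    (\prod_(l <- s) zexpg (z l) (n l))%g = 1%g ->
    forall l, l \in s -> n l = 0 }.

(* A letter [(x, true)] stands for the generator [x], [(x, false)] for its
   inverse. *)
Definition word (X : Type) := seq (X * bool).
Definition wlet (X : Type) (x : X) : word X := [:: (x, true)].
Definition wpos (X : Type) (s : seq X) : word X := [seq (x, true) | x <- s].
Definition winv (X : Type) (w : word X) : word X :=
  rev [seq (p.1, ~~ p.2) | p <- w].
(* [u, v] = u v u^-1 v^-1; this is not the convention of [commg]. *)
Definition wcomm (X : Type) (u v : word X) : word X :=
  u ++ v ++ winv u ++ winv v.

Definition weyl_rels (X : choiceType) (L : Type) (f : L -> seq X) :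
    set (word X) :=
  [set r | (exists x, r = wlet x ++ wlet x) \/ (exists l, r = wpos (f l))].

Definition hweyl_rels (X : choiceType) (L : Type) (f : L -> seq X) :
    set (word X) :=
  [set r | (exists x, r = wlet x ++ wlet x) \/
           (exists x l, r = wcomm (wlet x) (wpos (f l)))].

Section Presentation.
Variables (X : choiceType) (rels : set (word X)).

Inductive weq : word X -> word X -> Prop :=
| weq_refl u : weq u u
| weq_sym u v : weq u v -> weq v u
| weq_trans u v w : weq u v -> weq v w -> weq u w
| weq_cat u u' v v' : weq u u' -> weq v v' -> weq (u ++ v) (u' ++ v')
| weq_cancel x b : weq [:: (x, b); (x, ~~ b)] [::]
| weq_rel r : rels r -> weq r [::].

Definition weqb (u v : word X) := `[< weq u v >].

Lemma weqb_equiv : equiv_class_of weqb.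
Proof.
split=> [u|u v|v u w]; first exact/asboolP/weq_refl.
  by apply/asboolP/asboolP; apply: weq_sym.
by move=> /asboolP h1 /asboolP h2; apply/asboolP/(weq_trans h1 h2).
Qed.

Canonical weq_equivRel := EquivRelPack weqb_equiv.

Definition pres := {eq_quot weq_equivRel}.
HB.instance Definition _ := Choice.on pres.
HB.instance Definition _ := EqQuotient.on pres.

Lemma pres_eqP u v : \pi_pres u = \pi_pres v <-> weq u v.
Proof.
by split=> [/eqP|h]; [rewrite eqmodE => /asboolP|apply/eqP; rewrite eqmodE; apply/asboolP].
Qed.

Lemma repr_weq u : weq (repr (\pi_pres u)) u.
Proof. by apply/pres_eqP; rewrite reprK. Qed.

Definition pone : pres := \pi_pres [::].
Definition pmul (a b : pres) : pres := \pi_pres (repr a ++ repr b).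
Definition pinv (a : pres) : pres := \pi_pres (winv (repr a)).

Lemma winv_cat (u v : word X) : winv (u ++ v) = winv v ++ winv u.
Proof. by rewrite /winv map_cat rev_cat. Qed.

Lemma winvK : involutive (@winv X).
Proof.
move=> w; rewrite /winv map_rev revK -map_comp -[RHS]map_id.
by apply: eq_map => -[x b] /=; rewrite negbK.
Qed.

Lemma weq_winvr u : weq (u ++ winv u) [::].
Proof.
elim: u => [|[x b] u IH]; first exact: weq_refl.
rewrite -cat1s winv_cat -catA [u ++ _]catA.
apply: weq_trans (weq_cancel x b).
apply: (@weq_cat [:: (x, b)] [:: (x, b)] _ (winv [:: (x, b)])); first exact: weq_refl.
rewrite -[X in weq _ X]cat0s; apply: weq_cat => //; exact: weq_refl.
Qed.

Lemma weq_winvl u : weq (winv u ++ u) [::].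
Proof. by rewrite -{2}[u]winvK; apply: weq_winvr. Qed.

Lemma pmulE u v : pmul (\pi u) (\pi v) = \pi_pres (u ++ v).
Proof. by apply/pres_eqP/weq_cat; apply: repr_weq. Qed.

Lemma weq_winv u v : weq u v -> weq (winv u) (winv v).
Proof.
move=> h; rewrite -[winv u]cats0.
apply: weq_trans (weq_cat (weq_refl _) (weq_sym (weq_winvr v))) _.
rewrite catA -[X in weq _ X]cat0s; apply: weq_cat; last exact: weq_refl.
by apply: weq_trans (weq_winvl u); apply: weq_cat; [apply: weq_refl|apply: weq_sym].
Qed.

Lemma pinvE u : pinv (\pi u) = \pi_pres (winv u).
Proof. exact/pres_eqP/weq_winv/repr_weq. Qed.

Lemma pmulA : associative pmul.
Proof.
by elim/quotW=> u; elim/quotW=> v; elim/quotW=> w; rewrite !pmulE catA.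
Qed.
Lemma pmul1g : left_id pone pmul.
Proof. by elim/quotW=> u; rewrite /pone pmulE. Qed.
Lemma pmulg1 : right_id pone pmul.
Proof. by elim/quotW=> u; rewrite /pone pmulE cats0. Qed.
Lemma pmulVg : left_inverse pone pinv pmul.
Proof.
by elim/quotW=> u; rewrite pinvE pmulE; apply/pres_eqP/weq_winvl.
Qed.
Lemma pmulgV : right_inverse pone pinv pmul.
Proof.
by elim/quotW=> u; rewrite pinvE pmulE; apply/pres_eqP/weq_winvr.
Qed.

HB.instance Definition _ :=
  isGroup.Build pres pmulA pmul1g pmulg1 pmulVg pmulgV.

Definition pgen (x : X) : pres := \pi_pres (wlet x).

Section Universal.
Variables (H : groupType) (h : X -> H).

Definition wval (w : word X) : H :=
  (\prod_(p <- w) if p.2 then h p.1 else (h p.1)^-1)%g.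

Lemma pres_universal : (forall r, rels r -> wval r = 1%g) ->
  exists phi : {multiplicative pres -> H}, forall x, phi (pgen x) = h x.
Proof.
move=> hr.
have weqv u v : weq u v -> wval u = wval v.
  elim=> {u v}[//|//|u v w _ -> _ ->//|u u' v v' _ + _ +|x b|r /hr ->].
  - by rewrite /wval !big_cat => -> ->.
  - rewrite /wval !big_cons !big_nil mulg1.
    by case: b => /=; rewrite ?mulgV ?mulVg.
  - by rewrite /wval big_nil.
pose phi (a : pres) := wval (repr a).
have phiM : {morph phi : a b / (a * b)%g}.
  move=> a b; rewrite /phi /wval -big_cat; exact/weqv/repr_weq.
pose M := isMultiplicative.Build _ _ phi phiM.
pose phi' : {multiplicative pres -> H} := HB.pack phi M.
exists phi' => x /=; rewrite /phi (weqv _ _ (repr_weq _)) /wval.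
by rewrite big_seq1.
Qed.

End Universal.

End Presentation.

Record map_monoid (T : Type) := MapMonoid {
  map_mem :> (T -> T) -> Prop;
  map_mem_id : map_mem idfun;
  map_mem_comp : forall f g, map_mem f -> map_mem g -> map_mem (f \o g) }.

Section Automorphisms.
Variables (T : Type) (P : map_monoid T).

Record aut := Aut {
  aut_fun :> T -> T;
  aut_inv : T -> T;
  aut_mem : P aut_fun;
  aut_inv_mem : P aut_inv;
  autK : cancel aut_fun aut_inv;
  autVK : cancel aut_inv aut_fun }.

HB.instance Definition _ := gen_eqMixin aut.
HB.instance Definition _ := gen_choiceMixin aut.

Lemma autP (f g : aut) : (forall x, f x = g x) -> f = g.
Proof.
case: f g => [f f' Pf Pf' fK f'K] [g g' Pg Pg' gK g'K] /= fg.
have {}fg : f = g by apply/funext.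
subst g; have fg' : f' = g'.
  by apply/funext => x; rewrite -{1}[x]g'K fK.
by subst g'; congr Aut; apply: Prop_irrelevance.
Qed.

Definition aut1 : aut :=
  @Aut idfun idfun (map_mem_id P) (map_mem_id P) (fun=> erefl) (fun=> erefl).
Definition autM (f g : aut) : aut :=
  @Aut (f \o g) (aut_inv g \o aut_inv f)
    (map_mem_comp (aut_mem f) (aut_mem g))
    (map_mem_comp (aut_inv_mem g) (aut_inv_mem f))
    (can_comp (@autK f) (@autK g)) (can_comp (@autVK g) (@autVK f)).
Definition autV (f : aut) : aut :=
  @Aut (aut_inv f) f (aut_inv_mem f) (aut_mem f) (@autVK f) (@autK f).

Lemma autMA : associative autM. Proof. by move=> f g h; apply: autP. Qed.
Lemma autM1g : left_id aut1 autM. Proof. by move=> f; apply: autP. Qed.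
Lemma autMg1 : right_id aut1 autM. Proof. by move=> f; apply: autP. Qed.
Lemma autMVg : left_inverse aut1 autV autM.
Proof. by move=> f; apply: autP => x; apply: autK. Qed.
Lemma autMgV : right_inverse aut1 autV autM.
Proof. by move=> f; apply: autP => x; apply: autVK. Qed.

HB.instance Definition _ := isGroup.Build aut autMA autM1g autMg1 autMVg autMgV.

End Automorphisms.

Lemma additive_id (A : zmodType) : zmod_morphism (@idfun A).
Proof. by []. Qed.
Lemma additive_comp (A : zmodType) (f g : A -> A) :
  zmod_morphism f -> zmod_morphism g -> zmod_morphism (f \o g).
Proof. by move=> hf hg x y; rewrite /= hg hf. Qed.
Definition additive_maps (A : zmodType) : map_monoid A :=
  MapMonoid (@additive_id A) (@additive_comp A).
Notation zAut A := (aut (additive_maps A)).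

Lemma linear_id (K : nzRingType) (V : lmodType K) : linear (@idfun V).
Proof. by []. Qed.
Lemma linear_comp (K : nzRingType) (V : lmodType K) (f g : V -> V) :
  linear f -> linear g -> linear (f \o g).
Proof. by move=> hf hg a x y; rewrite /= hg hf. Qed.
Definition linear_maps (K : nzRingType) (V : lmodType K) : map_monoid V :=
  MapMonoid (@linear_id K V) (@linear_comp K V).
Notation lAut V := (aut (linear_maps V)).

(* For an abelian group [A], [Q (x) A] is the localization of the Z-module [A]
   at the nonzero integers: the pair [(a, n)] stands for [1/(n+1) (x) a].
   [ratext_universal] is the universal property of the tensor product. *)
Section RatExt.
Variable A : zmodType.

Definition ratrel (x y : A * nat) : bool := `[< exists k,
  x.1 *+ (y.2.+1 * k.+1) = y.1 *+ (x.2.+1 * k.+1) >].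

Lemma ratrel_equiv : equiv_class_of ratrel.
Proof.
split=> [x|x y|y x z]; first by apply/asboolP; exists 0%N.
  by apply/asboolP/asboolP => -[k hk]; exists k.
move=> /asboolP[k hk] /asboolP[l hl]; apply/asboolP.
exists (y.2.+1 * k.+1 * l.+1).-1; rewrite prednK ?muln_gt0//.
have -> : (z.2.+1 * (y.2.+1 * k.+1 * l.+1) =
  y.2.+1 * k.+1 * (z.2.+1 * l.+1))%N by lia.
rewrite mulrnA hk -mulrnA.
have -> : (x.2.+1 * k.+1 * (z.2.+1 * l.+1) =
  z.2.+1 * l.+1 * (x.2.+1 * k.+1))%N by lia.
by rewrite mulrnA hl -mulrnA; congr (_ *+ _); lia.
Qed.

Canonical ratrel_equivRel := EquivRelPack ratrel_equiv.

Definition ratext := {eq_quot ratrel_equivRel}.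
HB.instance Definition _ := Choice.on ratext.
HB.instance Definition _ := EqQuotient.on ratext.

Definition ratfrac (a : A) (n : nat) : ratext := \pi_ratext (a, n.-1).
Definition ratnum (x : ratext) : A := (repr x).1.
Definition ratden (x : ratext) : nat := (repr x).2.+1.

Lemma ratfrac_eq a b n m : (0 < n)%N -> (0 < m)%N ->
  (ratfrac a n = ratfrac b m <->
   exists2 k, (0 < k)%N & a *+ (m * k) = b *+ (n * k)).
Proof.
move=> n0 m0; rewrite /ratfrac; split.
  move=> /eqP; rewrite eqmodE => /asboolP[k]/=; rewrite !prednK// => hk.
  by exists k.+1.
move=> [[//|k] _ hk]; apply/eqP; rewrite eqmodE; apply/asboolP.
by exists k; rewrite /= !prednK.
Qed.

Lemma ratden_gt0 x : (0 < ratden x)%N. Proof. by []. Qed.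

Lemma ratfracK x : ratfrac (ratnum x) (ratden x) = x.
Proof. by rewrite -[RHS]reprK /ratfrac /ratnum /ratden /=; case: (repr x). Qed.

Lemma ratfracW (P : ratext -> Prop) :
  (forall a n, (0 < n)%N -> P (ratfrac a n)) -> forall x, P x.
Proof. by move=> h x; rewrite -[x]ratfracK; apply: h. Qed.

Lemma ratfrac_repr a n : (0 < n)%N -> exists2 k, (0 < k)%N &
  ratnum (ratfrac a n) *+ (n * k) = a *+ (ratden (ratfrac a n) * k).
Proof. by move=> n0; apply/ratfrac_eq => //; rewrite ratfracK. Qed.

Definition ratadd (x y : ratext) : ratext :=
  ratfrac (ratnum x *+ ratden y + ratnum y *+ ratden x) (ratden x * ratden y).
Definition ratopp (x : ratext) : ratext := ratfrac (- ratnum x) (ratden x).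
Definition ratscale (q : rat) (x : ratext) : ratext :=
  ratfrac (ratnum x *~ numq q) (ratden x * `|denq q|).

Lemma rataddE a b n m : (0 < n)%N -> (0 < m)%N ->
  ratadd (ratfrac a n) (ratfrac b m) = ratfrac (a *+ m + b *+ n) (n * m).
Proof.
move=> n0 m0; rewrite /ratadd.
have [k k0 hk] := ratfrac_repr a n0; have [l l0 hl] := ratfrac_repr b m0.
set x := ratfrac a n in hk *; set y := ratfrac b m in hl *.
apply/ratfrac_eq; rewrite ?muln_gt0 ?n0 ?m0//.
exists (k * l)%N; rewrite ?muln_gt0 ?k0// !mulrnDl -!mulrnA.
congr (_ + _).
  have -> : (ratden y * (n * m * (k * l)) = n * k * (ratden y * m * l))%N by lia.
  by rewrite mulrnA hk -mulrnA; congr (_ *+ _); lia.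
have -> : (ratden x * (n * m * (k * l)) = m * l * (ratden x * n * k))%N by lia.
by rewrite mulrnA hl -mulrnA; congr (_ *+ _); lia.
Qed.

Lemma ratoppE a n : (0 < n)%N -> ratopp (ratfrac a n) = ratfrac (- a) n.
Proof.
move=> n0; have [k k0 hk] := ratfrac_repr a n0.
by apply/ratfrac_eq => //; exists k; rewrite // !mulNrn hk.
Qed.

Lemma ratscaleE q (m : int) (d : nat) a n : (0 < n)%N -> (0 < d)%N ->
  numq q * d%:Z = m * denq q ->
  ratscale q (ratfrac a n) = ratfrac (a *~ m) (n * d).
Proof.
move=> n0 d0 qE; have [k k0 hk] := ratfrac_repr a n0.
have q0 : (0 < `|denq q|)%N by rewrite absz_gt0 denq_neq0.
apply/ratfrac_eq; rewrite ?muln_gt0 ?n0 ?q0//.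
exists k => //; set x := ratfrac a n in hk *.
have -> : (n * d * k = n * k * d)%N by lia.
rewrite !pmulrn -!mulrzA.
have -> : numq q * (n * k * d)%:Z = (n * k)%:Z * (numq q * d%:Z).
  by rewrite PoszM mulrCA.
have -> : m * (ratden x * `|denq q| * k)%:Z = (ratden x * k)%:Z * (m * denq q).
  by rewrite !PoszM absz_denq; ring.
by rewrite qE !mulrzA -!pmulrn hk.
Qed.

Lemma rataddA : associative ratadd.
Proof.
elim/ratfracW=> a n n0; elim/ratfracW=> b m m0; elim/ratfracW=> c l l0.
rewrite !rataddE ?muln_gt0 ?n0 ?m0// !mulrnDl -!mulrnA addrA mulnA.
by congr (ratfrac (_ + _ *+ _ + _ *+ _) _); lia.
Qed.

Lemma rataddC : commutative ratadd.
Proof. by move=> x y; rewrite /ratadd addrC mulnC. Qed.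

Lemma ratadd0 : left_id (ratfrac 0 1) ratadd.
Proof.
by elim/ratfracW=> a n n0; rewrite rataddE// mul0rn add0r mul1n.
Qed.

Lemma rataddN : left_inverse (ratfrac 0 1) ratopp ratadd.
Proof.
elim/ratfracW=> a n n0; rewrite ratoppE// rataddE// mulNrn addNr.
by apply/ratfrac_eq; rewrite ?muln_gt0 ?n0//; exists 1%N; rewrite ?mul0rn.
Qed.

HB.instance Definition _ :=
  GRing.isZmodule.Build ratext rataddA rataddC ratadd0 rataddN.

Lemma ratscaleA q r x : ratscale q (ratscale r x) = ratscale (q * r) x.
Proof.
elim/ratfracW: x => a n n0.
have pos (s : rat) : (0 < `|denq s|)%N by rewrite absz_gt0 denq_neq0.
rewrite (@ratscaleE r (numq r) `|denq r|)// ?absz_denq//.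
rewrite (@ratscaleE q (numq q) `|denq q|) ?muln_gt0 ?n0 ?pos// ?absz_denq//.
rewrite (@ratscaleE _ (numq r * numq q) (`|denq r| * `|denq q|)) ?muln_gt0 ?pos//.
  by rewrite mulrzA mulnA.
apply: (@intr_inj rat); rewrite PoszM !absz_denq !rmorphM /= !numqE.
by ring.
Qed.

Lemma ratscale1 : left_id 1 ratscale.
Proof.
elim/ratfracW=> a n n0.
by rewrite (@ratscaleE 1 1 1)// mulr1z muln1.
Qed.

Lemma ratscaleDr : right_distributive ratscale ratadd.
Proof.
move=> q; elim/ratfracW=> a n n0; elim/ratfracW=> b m m0.
have q0 : (0 < `|denq q|)%N by rewrite absz_gt0 denq_neq0.
have qE c l : (0 < l)%N -> ratscale q (ratfrac c l) = ratfrac (c *~ numq q) (l * `|denq q|).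
  by move=> l0; rewrite (@ratscaleE q (numq q) `|denq q|)// absz_denq.
rewrite rataddE// !qE ?muln_gt0 ?n0// rataddE ?muln_gt0 ?n0 ?m0//.
apply/ratfrac_eq; rewrite ?muln_gt0 ?n0 ?m0 ?q0//; exists 1%N => //.
rewrite !pmulrn !mulrzDl -!mulrzA.
by congr (_ *~ _ + _ *~ _); rewrite !PoszM; ring.
Qed.

Lemma ratscaleDl x : {morph ratscale^~ x : q r / q + r >-> ratadd q r}.
Proof.
move=> q r; elim/ratfracW: x => a n n0.
have pos (s : rat) : (0 < `|denq s|)%N by rewrite absz_gt0 denq_neq0.
have qE s : ratscale s (ratfrac a n) = ratfrac (a *~ numq s) (n * `|denq s|).
  by rewrite (@ratscaleE s (numq s) `|denq s|)// absz_denq.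
rewrite [LHS](@ratscaleE _ (numq q * denq r + numq r * denq q)
  (`|denq q| * `|denq r|)) ?muln_gt0 ?pos//; last first.
  apply: (@intr_inj rat); rewrite PoszM !absz_denq.
  by rewrite !rmorphM /= rmorphD /= !rmorphM /= !numqE; ring.
rewrite !qE rataddE ?muln_gt0 ?n0 ?pos//.
apply/ratfrac_eq; rewrite ?muln_gt0 ?n0 ?pos//; exists 1%N => //.
rewrite !pmulrn !mulrzDl -!mulrzA -!mulrzDr.
congr (_ *~ _).
by rewrite !PoszM !absz_denq; ring.
Qed.

HB.instance Definition _ := GRing.Zmodule_isLmodule.Build rat ratext
  ratscaleA ratscale1 ratscaleDr ratscaleDl.

Definition ratinj (a : A) : ratext := ratfrac a 1.

Lemma ratinjB : zmod_morphism ratinj.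
Proof.
move=> a b; rewrite -[LHS]/(ratfrac (a - b) 1).
have -> : ratinj a - ratinj b = ratadd (ratinj a) (ratopp (ratinj b)) by [].
by rewrite ratoppE// rataddE.
Qed.
HB.instance Definition _ := GRing.isZmodMorphism.Build A ratext ratinj ratinjB.

Lemma ratfracE a n : (0 < n)%N -> ratfrac a n = n%:R^-1 *: ratinj a.
Proof.
move=> n0; rewrite -[RHS]/(ratscale _ (ratfrac a 1)).
rewrite (@ratscaleE _ 1 n)// ?mulr1z ?mul1n//.
have nz : n%:R != 0 :> rat by rewrite pnatr_eq0 -lt0n.
apply: (@intr_inj rat); rewrite !rmorphM /= numqE mul1r.
by rewrite -mulrA mulrCA -[n%:~R]/(n%:R) mulVf ?mulr1 ?mul1r.
Qed.

Lemma ratinj_inj : (forall a n, a *+ n.+1 = 0 -> a = 0 :> A) -> injective ratinj.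
Proof.
move=> tf a b /ratfrac_eq[]// [//|k] _; rewrite !mul1n => /eqP.
by rewrite -subr_eq0 -mulrnBl => /eqP/tf/eqP; rewrite subr_eq0 => /eqP.
Qed.

Lemma ratext_universal (M : lmodType rat) (f : {additive A -> M}) :
  exists2 g : {linear ratext -> M}, (forall a, g (ratinj a) = f a) &
  forall h : {linear ratext -> M}, (forall a, h (ratinj a) = f a) -> h =1 g.
Proof.
pose g (x : ratext) : M := (ratden x)%:R^-1 *: f (ratnum x).
have gE a n : (0 < n)%N -> g (ratfrac a n) = n%:R^-1 *: f a.
  move=> n0; have [k k0 hk] := ratfrac_repr a n0.
  have nz i : (0 < i)%N -> i%:R != 0 :> rat by rewrite pnatr_eq0 lt0n.
  set x := ratfrac a n in hk *; rewrite /g.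
  have := congr1 f hk; rewrite !raddfMn/= -!scaler_nat => hk'.
  have -> : (ratden x)%:R^-1 *: f (ratnum x) =
    ((ratden x)%:R^-1 / (n * k)%:R) *: ((n * k)%:R *: f (ratnum x)).
    by rewrite scalerA mulfVK// nz// muln_gt0 n0.
  rewrite hk' scalerA; congr (_ *: _); rewrite !natrM.
  by field; rewrite !nz.
have pos (s : rat) : (0 < `|denq s|)%N by rewrite absz_gt0 denq_neq0.
have gP : linear g.
  move=> q x y; elim/ratfracW: x => a n n0; elim/ratfracW: y => b m m0.
  have -> : q *: ratfrac a n + ratfrac b m =
      ratfrac ((a *~ numq q) *+ m + b *+ (n * `|denq q|)) (n * `|denq q| * m).
    rewrite -rataddE ?muln_gt0 ?n0 ?pos// -(@ratscaleE q)// absz_denq//.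
  have nz i : (0 < i)%N -> i%:R != 0 :> rat by rewrite pnatr_eq0 lt0n.
  rewrite !gE ?muln_gt0 ?n0 ?pos// raddfD/= !raddfMn/= raddfMz/=.
  rewrite -!scaler_nat -scaler_int !scalerDr !scalerA.
  have dE : (denq q)%:~R = `|denq q|%:R :> rat by rewrite -[in LHS]absz_denq.
  have qE : q = (numq q)%:~R / `|denq q|%:R by rewrite -dE divq_num_den.
  have dnz : `|denq q|%:R != 0 :> rat by rewrite nz// pos.
  move: (numq q)%:~R `|denq q|%N qE dnz => p d -> dnz.
  have E1 (x y z t : rat) : z != 0 -> (x * y * z)^-1 * (z * t) = t / y / x.
    by move=> z0; rewrite invfM -[LHS]mulrA mulKf// invfM mulrC mulrA mulrAC.
  have E2 (x y z : rat) : x * y != 0 -> (x * y * z)^-1 * (x * y) = z^-1.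
    by move=> xy0; rewrite invfM mulrAC mulVf ?mul1r.
  by congr (_ *: _ + _ *: _); rewrite !natrM ?(E1, E2)// ?mulf_neq0// nz.
pose L := GRing.isLinear.Build _ _ _ _ g gP.
pose g' : {linear ratext -> M} := HB.pack g L.
exists g' => [a|h hf x]; first by rewrite /= gE// invr1 scale1r.
by elim/ratfracW: x => a n n0; rewrite /= gE// ratfracE// linearZ/= hf.
Qed.

End RatExt.

Definition torsion_free (A : zmodType) :=
  forall (a : A) n, a *+ n.+1 = 0 -> a = 0.

Record psd_form (A : zmodType) := PsdForm {
  form_fun :> A -> A -> rat;
  formDl : forall a b c, form_fun (a + b) c = form_fun a c + form_fun b c;
  formC : forall a b, form_fun a b = form_fun b a;
  form_ge0 : forall a, 0 <= form_fun a a;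
  form_nontrivial : exists a b, form_fun a b != 0 }.

(* [cpair f b a] is (b, a^\vee) for the form [f]. *)
Definition cpair (T : Type) (f : T -> T -> rat) (b a : T) : rat :=
  if f a a != 0 then 2 * f b a / f a a else 0.

Definition zspan (A : zmodType) (X : set A) : set A := [set a |
  forall H : {pred A}, zmod_closed H -> (forall x, X x -> x \in H) -> a \in H].

Section AffineReflectionSystem.
Variables (A : zmodType) (form : psd_form A).

Definition radical : set A := [set a | forall b, form a b = 0].

Definition nonisotropic (B : set A) : set A := B `\` radical.
Definition isotropic (B : set A) : set A := B `&` radical.

Record affine_reflection_system (R : set A) : Prop := {
  ars_opp : [set - a | a in R] = R;
  ars_gen : zspan R = setT;
  ars_string : forall a b, nonisotropic R a -> R b -> exists d u : nat,
    [set b + a *~ n | n in [set: int]] `&` R =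
      [set b + a *~ n | n in [set n : int | - d%:Z <= n <= u%:Z]]
    /\ d%:R - u%:R = cpair form b a }.

Definition irreducible_ars (R : set A) : Prop := ~ exists P Q : set A,
  [/\ P !=set0, Q !=set0, P `&` Q = set0, P `|` Q = nonisotropic R &
      forall a b, P a -> Q b -> form a b = 0].

Definition tame_ars (R : set A) : Prop :=
  isotropic R `<=` [set a - b | a in nonisotropic R & b in nonisotropic R].

(* The image of [R] in [A / A^0] is [{0, e, - e}] for some nonzero class [e]. *)
Definition type_A1 (R : set A) : Prop := exists2 e : A, ~ radical e &
  forall b, (exists2 a, R a & radical (a - b)) <->
            [\/ radical b, radical (b - e) | radical (b + e)].

Lemma form0l b : form 0 b = 0.
Proof. by apply: (@addrI _ (form 0 b)); rewrite -formDl !addr0. Qed.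

Lemma formBl a b c : form (a - b) c = form a c - form b c.
Proof. by apply/eqP; rewrite eq_sym subr_eq -formDl subrK. Qed.

Lemma formMzl n a b : form (a *~ n) b = n%:~R * form a b.
Proof.
have hn (m : nat) : form (a *+ m) b = m%:R * form a b.
  elim: m => [|m IH]; first by rewrite form0l mul0r.
  by rewrite mulrS formDl IH -natr1 mulrDl mul1r addrC.
case: n => n; first exact: hn.
by rewrite NegzE mulrNz -sub0r formBl form0l hn rmorphN mulNr sub0r.
Qed.

Lemma radical0 : radical 0. Proof. by move=> b; exact: form0l. Qed.
Lemma radicalB a b : radical a -> radical b -> radical (a - b).
Proof. by move=> ha hb c; rewrite formBl ha hb subrr. Qed.
Lemma radicalMz n a : radical a -> radical (a *~ n).
Proof. by move=> ha c; rewrite formMzl ha mulr0. Qed.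
Lemma radicalMn n a : radical a -> radical (a *+ n).
Proof. by rewrite pmulrn; apply: radicalMz. Qed.
Lemma radicalD a b : radical a -> radical b -> radical (a + b).
Proof. by move=> ha hb c; rewrite formDl ha hb addr0. Qed.

Definition integral_coroot (a : A) := forall b, cpair form b a \is a Num.int.

Lemma cpairBl a b c : cpair form (b - c) a = cpair form b a - cpair form c a.
Proof.
rewrite /cpair; case: ifP => _; last by rewrite subrr.
by rewrite formBl mulrBr mulrBl.
Qed.

Lemma ars_integral R a : affine_reflection_system R -> R a -> integral_coroot a.
Proof.
move=> hR Ra b; have [a0|/eqP na] := boolP (form a a == 0).
  by rewrite /cpair a0.
pose H : {pred A} := [pred b | cpair form b a \is a Num.int].
suff: b \in H by [].
have: zspan R b by rewrite (ars_gen hR).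
apply.
  split=> [|x y]; first by rewrite inE /cpair form0l mulr0 mul0r if_same rpred0.
  by rewrite !inE cpairBl => hx hy; apply: rpredB.
move=> x Rx; have [|d [u [_ E]]] := @ars_string _ hR a x _ Rx.
  by split=> // /(_ a).
by rewrite inE -E rpredB// rpred_nat.
Qed.

(* For [a] in an affine reflection system all the numbers (b, a^\vee) are
   integers ([ars_integral]) and taking the integer part changes nothing. *)
Definition refl_fun (a b : A) : A := b - a *~ Num.floor (cpair form b a).

Lemma refl_funB a : integral_coroot a -> zmod_morphism (refl_fun a).
Proof.
move=> ha b c; rewrite /refl_fun cpairBl.
have /intrP[m ->] := ha b; have /intrP[n ->] := ha c.
rewrite -rmorphB /= !intrKfloor mulrzBr.
by rewrite opprD addrACA -opprD.
Qed.

Lemma refl_funK a : integral_coroot a -> involutive (refl_fun a).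
Proof.
move=> ha b; rewrite /refl_fun.
have /intrP[n E] := ha b; rewrite E intrKfloor cpairBl E.
have -> : cpair form (a *~ n) a = (n + n)%:~R.
  rewrite rmorphD /=; move: E; rewrite /cpair formMzl; case: ifP => [a0 _|_ <-].
    by rewrite mulrCA mulrA mulfK// -mulr2n mulrC mulr_natl.
  by rewrite addr0.
rewrite -rmorphB /= intrKfloor opprD addrA subrr sub0r mulrNz opprK.
by rewrite subrK.
Qed.

Definition refl (a : A) : zAut A :=
  if pselect (integral_coroot a) is left ha then
    @Aut _ (additive_maps A) (refl_fun a) (refl_fun a)
      (refl_funB ha) (refl_funB ha) (refl_funK ha) (refl_funK ha)
  else 1%g.

Lemma reflE R a b : affine_reflection_system R -> R a ->
  exists2 n : int, n%:~R = cpair form b a & refl a b = b - a *~ n.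
Proof.
move=> hR Ra; have ha := ars_integral hR Ra.
exists (Num.floor (cpair form b a)); first by rewrite floorK.
by rewrite /refl; case: pselect.
Qed.

Definition weyl (P : set A) := gen_group (refl @` P).

Definition weyl_refl (P : set A) (a : P) : weyl P :=
  GenGroup (mem_gen (imageP refl (set_valP a))).

Definition reflectable (R P : set A) : Prop :=
  P `<=` nonisotropic R /\
  [set (gen_val w) a | w in [set: weyl P] & a in P] = nonisotropic R.

Definition set_incl (P Q : set A) (h : P `<=` Q) (a : P) : Q :=
  exist _ (val a) (mem_set (h _ (set_valP a))).

Lemma reflectable_sub R P : reflectable R P -> P `<=` R.
Proof. by move=> [h _] a /h []. Qed.

End AffineReflectionSystem.

Record A1_decomposition (A : zmodType) (form : psd_form A) (R : set A) :=
  A1Decomposition {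
  eps : A;
  isoS : set A;
  isoS_sub : isoS `<=` isotropic form R;
  isoS0 : isoS 0;
  isoSD : [set a + b *+ 2 | a in isoS & b in isoS] `<=` isoS;
  isoSB : [set a - b *+ 2 | a in isoS & b in isoS] `<=` isoS;
  isoS_gen : zspan isoS = radical form;
  A1_roots : R = [set a + b | a in isoS & b in isoS] `|`
                 [set a + b | a in [set 0; eps; - eps] & b in isoS];
  A1_sum : forall a, exists n : int, radical form (a - eps *~ n);
  A1_direct : forall n : int, radical form (eps *~ n) -> n = 0;
  A1_norm : form eps eps = 2 }.

Section Alternating.
Variables (A : zmodType) (form : psd_form A) (R : set A).
Variable D : A1_decomposition form R.

Definition sgnA (a : A) : int := projT1 (cid (A1_sum D a)).
Definition pA (a : A) : A := a - eps D *~ sgnA a.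

Lemma pA_radical a : radical form (pA a).
Proof. exact: projT2 (cid (A1_sum D a)). Qed.

(* The tuple is indexed from 0 here, hence the exponent [j.+1]. *)
Definition Alt (P : set A) : set (seq P) := [set f : seq P | ~~ odd (size f) /\
  \sum_(j < size f) (let a := val (tnth (in_tuple f) j) in
    pA a *~ ((-1) ^+ j.+1 * sgnA a)) = 0].

End Alternating.

Section FormOnRatExt.
Variables (A : zmodType) (form : psd_form A).

Definition formV (x y : ratext A) : rat :=
  form (ratnum x) (ratnum y) / ((ratden x)%:R * (ratden y)%:R).

Lemma form_ratnum a n b : (0 < n)%N ->
  form (ratnum (ratfrac a n)) b / (ratden (ratfrac a n))%:R = form a b / n%:R.
Proof.
move=> n0; have [k k0 hk] := ratfrac_repr a n0.
have nz i : (0 < i)%N -> i%:R != 0 :> rat by rewrite pnatr_eq0 lt0n.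
have := congr1 (form^~ b) hk; set x := ratfrac a n in hk *.
rewrite !pmulrn !formMzl -!pmulrn !natrM => E.
apply/eqP; rewrite eqr_div ?nz//; apply/eqP/(mulIf (nz _ k0)).
by rewrite -[LHS]mulrA [LHS]mulrC E [LHS]mulrC mulrA.
Qed.

Lemma formVE a n b m : (0 < n)%N -> (0 < m)%N ->
  formV (ratfrac a n) (ratfrac b m) = form a b / (n%:R * m%:R).
Proof.
move=> n0 m0; rewrite /formV !invfM !mulrA.
by rewrite form_ratnum// mulrAC formC form_ratnum// formC mulrAC.
Qed.

Lemma formV_ratinj a b : formV (ratinj a) (ratinj b) = form a b.
Proof. by rewrite formVE// invfM invr1 !mulr1. Qed.

Lemma formVC x y : formV x y = formV y x.
Proof. by rewrite /formV formC [_%:R * _]mulrC. Qed.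

Lemma formV_linear y : linear_for *%R (formV^~ y).
Proof.
elim/ratfracW: y => c l l0 q x y; elim/ratfracW: x => a n n0; elim/ratfracW: y => b m m0.
have nz i : (0 < i)%N -> i%:R != 0 :> rat by rewrite pnatr_eq0 lt0n.
have pos (s : rat) : (0 < `|denq s|)%N by rewrite absz_gt0 denq_neq0.
have -> : q *: ratfrac a n + ratfrac b m =
    ratfrac ((a *~ numq q) *+ m + b *+ (n * `|denq q|)) (n * `|denq q| * m).
  by rewrite -rataddE ?muln_gt0 ?n0 ?pos// -(@ratscaleE _ q)// absz_denq.
rewrite !formVE ?muln_gt0 ?n0 ?pos// formDl !pmulrn !formMzl -!pmulrn.
have dE : (denq q)%:~R = `|denq q|%:R :> rat by rewrite -[in LHS]absz_denq.
have qE : q = (numq q)%:~R / `|denq q|%:R by rewrite -dE divq_num_den.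
rewrite [in RHS]qE; move: (form a c) (form b c) => u v.
have E (x y z t w u' v' : rat) : x != 0 -> y != 0 -> z != 0 -> t != 0 ->
    (z * (w * u') + (x * y) * v') / (x * y * z * t) =
    w / y * (u' / (x * t)) + v' / (z * t).
  by move=> x0 y0 z0 t0; field; rewrite x0 y0 z0 t0.
by rewrite !natrM E// nz.
Qed.

(* [V^0 = Q (x) A^0], as a subspace of [V]. *)
Definition V0_pred : {pred ratext A} := [pred v | `[< exists a n,
  [/\ radical form a, (0 < n)%N & v = ratfrac a n] >]].

Record V0 := MkV0 {V0val :> ratext A; V0valP : V0val \in V0_pred}.

HB.instance Definition _ := [isSub for V0val].
HB.instance Definition _ := [Choice of V0 by <:].

Lemma V0_closed : submod_closed V0_pred.
Proof.
split.
  by apply/asboolP; exists 0, 1%N; split => //; exact: radical0.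
move=> q x y /asboolP[a [n [ha n0 ->]]] /asboolP[b [m [hb m0 ->]]].
have pos : (0 < `|denq q|)%N by rewrite absz_gt0 denq_neq0.
apply/asboolP; exists ((a *~ numq q) *+ m + b *+ (n * `|denq q|))%R, (n * `|denq q| * m)%N.
split; rewrite ?muln_gt0 ?n0 ?pos//.
  by apply: radicalD; apply: radicalMn => //; apply: radicalMz.
by rewrite -rataddE ?muln_gt0 ?n0 ?pos// -(@ratscaleE _ q)// absz_denq.
Qed.

HB.instance Definition _ :=
  GRing.SubChoice_isSubLmodule.Build rat (ratext A) V0_pred V0 V0_closed.

Lemma V0_formV (v : V0) y : formV (val v) y = 0.
Proof.
case: v => v /= /asboolP[a [n [ha n0 ->]]]; elim/ratfracW: y => b m m0.
by rewrite formVE// ha mul0r.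
Qed.

End FormOnRatExt.

Definition is_basis (K : fieldType) (V : lmodType K) (J : choiceType)
    (v : J -> V) : Prop :=
  (forall (s : seq J) (c : J -> K), uniq s ->
     \sum_(j <- s) c j *: v j = 0 -> forall j, j \in s -> c j = 0) /\
  (forall x, exists (s : seq J) (c : J -> K), x = \sum_(j <- s) c j *: v j).

Section Hyperbolic.
Variables (A : zmodType) (form : psd_form A) (R : set A).
Variable D : A1_decomposition form R.
Variables (J : choiceType) (lam : J -> {linear V0 form -> rat^o}).

Definition dag_pred : {pred (V0 form -> rat^o)} := [pred f | `[<
  exists s : seq (rat * J),
    f = \sum_(p <- s) p.1 *: (lam p.2 : V0 form -> rat^o) >]].

Record dag := MkDag {dagval :> V0 form -> rat^o; dagvalP : dagval \in dag_pred}.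

HB.instance Definition _ := [isSub for dagval].
HB.instance Definition _ := [Choice of dag by <:].

Lemma dag_closed : submod_closed dag_pred.
Proof.
split; first by apply/asboolP; exists [::]; rewrite big_nil.
move=> q f g /asboolP[s ->] /asboolP[t ->]; apply/asboolP.
exists ([seq (q * p.1, p.2) | p <- s] ++ t).
rewrite big_cat big_map scaler_sumr; congr (_ + _).
by apply: eq_bigr => p _; rewrite scalerA.
Qed.

HB.instance Definition _ :=
  GRing.SubChoice_isSubLmodule.Build rat (V0 form -> rat^o) dag_pred dag dag_closed.

Definition hypV : lmodType rat := (ratext A * dag)%type.

Lemma proj0_subproof (v : ratext A) :
  v - (formV form v (ratinj (eps D)) / form (eps D) (eps D)) *: ratinj (eps D)
    \in V0_pred form.
Proof.
elim/ratfracW: v => a n n0; have [k hk] := A1_sum D a.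
apply/asboolP; exists (a - eps D *~ k), n; split=> //.
have -> : ratfrac a n = n%:R^-1 *: ratinj a by rewrite ratfracE.
rewrite [RHS]ratfracE// raddfB/= raddfMz/= -scaler_int scalerBr scalerA.
congr (_ - _ *: _).
have -> : n%:R^-1 *: ratinj a = n%:R^-1 *: ratinj a + 0 by rewrite addr0.
rewrite formV_linear [formV _ 0 _]formVE// form0l mul0r addr0 formV_ratinj.
have := hk (eps D); rewrite formBl formMzl => /eqP; rewrite subr_eq0 => /eqP ->.
by rewrite -!mulrA mulfV ?mulr1// A1_norm.
Qed.

(* The projection of [V = Q eps + V^0] onto [V^0]. *)
Definition proj0 (v : ratext A) : V0 form := MkV0 (proj0_subproof v).

Lemma proj0_linear : linear proj0.
Proof.
move=> q x y; apply: val_inj; rewrite [RHS]linearP /=.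
rewrite formV_linear mulrDl scalerDl scalerBr !scalerA opprD addrACA.
by rewrite -mulrA.
Qed.

Lemma proj0_V0 (v : V0 form) : proj0 (val v) = v.
Proof. by apply: val_inj; rewrite /= V0_formV mul0r scale0r subr0. Qed.

Lemma proj0_eps : proj0 (ratinj (eps D)) = 0.
Proof.
by apply: val_inj; rewrite /= formV_ratinj divff ?A1_norm// scale1r subrr.
Qed.

Definition formH (x y : hypV) : rat :=
  formV form x.1 y.1 + (x.2 (proj0 y.1) + y.2 (proj0 x.1)).

Lemma formH_V u v : formH (u, 0) (v, 0) = formV form u v.
Proof. by rewrite /formH /= !addr0. Qed.

Lemma formH_eps_dag (l : dag) : formH (ratinj (eps D), 0) (0, l) = 0.
Proof.
rewrite /formH /= proj0_eps formVC formVE// form0l mul0r.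
case: l => f /= /asboolP[s ->]; rewrite !add0r fct_sumE big1// => p _.
by rewrite -[LHS]/(p.1 * lam p.2 0) linear0 mulr0.
Qed.

Lemma formH_dag_dag (l m : dag) : formH (0, l) (0, m) = 0.
Proof.
have p0 : proj0 0 = 0.
  by apply: val_inj; rewrite /= formVE// form0l !mul0r scale0r subr0.
have h0 (k : dag) : k 0 = 0.
  case: k => f /= /asboolP[s ->]; rewrite fct_sumE big1// => p _.
  by rewrite -[LHS]/(p.1 * lam p.2 0) linear0 mulr0.
by rewrite /formH /= p0 !h0 formVE// form0l mul0r !addr0.
Qed.

Lemma formH_V0_dag (v : V0 form) (l : dag) :
  formH (val v, 0) (0, l) = l v.
Proof. by rewrite /formH /= V0_formV proj0_V0 !add0r. Qed.

Lemma formHC x y : formH x y = formH y x.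
Proof. by rewrite /formH formVC [x.2 _ + _]addrC. Qed.

Lemma dag_linear (l : dag) : linear_for *%R l.
Proof.
case: l => f /= /asboolP[s ->] q x y.
rewrite !fct_sumE mulr_sumr -big_split; apply: eq_bigr => p _.
rewrite -[LHS]/(p.1 * lam p.2 (q *: x + y)) linearD linearZ.
by rewrite mulrDr -[X in p.1 * X + _]/(q * lam p.2 x) mulrCA.
Qed.

Lemma formH_linear y : linear_for *%R (formH^~ y).
Proof.
move=> q x z; rewrite /formH /=.
rewrite formV_linear proj0_linear dag_linear.
rewrite [X in _ + (X + _) = _](_ : _ = q * x.2 (proj0 y.1) + z.2 (proj0 y.1))//.
by rewrite !mulrDr; ring.
Qed.

Definition hrefl_fun (a : ratext A) (b : hypV) : hypV :=
  b - cpair formH b (a, 0) *: ((a, 0) : hypV).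

Lemma cpairH_linear a : linear_for *%R (cpair formH ^~ a).
Proof.
move=> q x y; rewrite /cpair; case: ifP => _; last by rewrite mulr0 addr0.
by rewrite formH_linear mulrDr mulrDl; ring.
Qed.

Lemma hrefl_linear a : linear (hrefl_fun a).
Proof.
move=> q x y; rewrite /hrefl_fun cpairH_linear.
by rewrite scalerDl opprD addrACA scalerBr scalerA.
Qed.

Lemma hreflK a : involutive (hrefl_fun a).
Proof.
move=> b; rewrite {1}/hrefl_fun; set u : hypV := (a, 0).
have -> : cpair formH (hrefl_fun a b) u = - cpair formH b u.
  rewrite /hrefl_fun -/u -scaleNr addrC cpairH_linear.
  rewrite /cpair; case: ifP => [u0|_]; last by rewrite mulr0 addr0 oppr0.
  by field.
by rewrite scaleNr opprK /hrefl_fun subrK.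
Qed.

Definition hrefl (a : ratext A) : lAut hypV :=
  @Aut _ (linear_maps hypV) (hrefl_fun a) (hrefl_fun a)
    (hrefl_linear a) (hrefl_linear a) (hreflK a) (hreflK a).

Definition hweyl := gen_group [set hrefl (ratinj a) | a in R].

Definition hweyl_refl (a : R) : hweyl :=
  GenGroup (mem_gen (imageP (hrefl \o ratinj (A:=A)) (set_valP a))).

End Hyperbolic.

(* Main.v *)
(* Both presented groups receive the words in the letters [Pi], so each of the
   two isomorphisms amounts to a faithfulness statement: a word that is trivial
   in the reflection group is trivial in the presented group.  The hyperbolic
   Weyl group maps onto the Weyl group, and the kernel is central because an
   isometry fixing [V] pointwise conjugates every reflection to itself.  The
   central elements [z l] die in the Weyl group by the alternating condition, so
   the Weyl group is the quotient of the hyperbolic one by the free abelian group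
   on the [z l], just as the first presented group is the quotient of the second
   by its central elements [f l]; comparing exponents transfers faithfulness in
   both directions. *)

Require Import Defs.
From HB Require Import structures.
From mathcomp Require Import all_boot all_order all_algebra.
From mathcomp Require Import all_classical.
From mathcomp Require Import ring zify.

Set Implicit Arguments.
Unset Strict Implicit.
Unset Printing Implicit Defensive.

Import Order.TTheory GRing.Theory Num.Theory.

Local Open Scope classical_set_scope.
Local Open Scope ring_scope.

(** * Values of words in groups *)

Section Words.
Local Open Scope group_scope.

Section Wval.
Variables (X : choiceType) (H : groupType) (h : X -> H).

Lemma wval_nil : wval h [::] = 1.
Proof. exact: big_nil. Qed.

Lemma wval_cons p w :
  wval h (p :: w) = (if p.2 then h p.1 else (h p.1)^-1) * wval h w.
Proof. exact: big_cons. Qed.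

Lemma wval_cat u v : wval h (u ++ v) = wval h u * wval h v.
Proof. exact: big_cat. Qed.

Lemma wval_winv w : wval h (winv w) = (wval h w)^-1.
Proof.
elim: w => [|[x b] w IH]; first by rewrite wval_nil invg1.
rewrite -cat1s winv_cat !wval_cat IH invgM; congr (_ * _).
by rewrite !wval_cons !wval_nil !mulg1; case: b => //=; rewrite invgK.
Qed.

Lemma wval_wlet x : wval h (wlet x) = h x.
Proof. by rewrite wval_cons wval_nil mulg1. Qed.

Lemma wval_wpos s : wval h (wpos s) = \prod_(x <- s) h x.
Proof. by rewrite /wval big_map. Qed.

Lemma wval_ind (P : {pred H}) :
  group_closed P -> (forall x, h x \in P) -> forall w, wval h w \in P.
Proof.
move=> Pgrp Ph; elim=> [|[x b] w IH]; first by rewrite wval_nil; case: Pgrp.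
rewrite wval_cons; apply: (group_closedM Pgrp) => //.
by case: b; rewrite /= ?(group_closedV Pgrp).
Qed.

Lemma commute_wval g w : (forall x, commute g (h x)) -> commute g (wval h w).
Proof.
move=> gh; elim: w => [|[x b] w IH]; first by rewrite wval_nil; apply: commute1.
rewrite wval_cons; apply: commuteM => //.
by case: b => /=; [|apply: commuteV].
Qed.

End Wval.

Section Morphisms.
Variables (G H : groupType) (f : {multiplicative G -> H}).

Lemma mult1 : f 1 = 1.
Proof. by apply: (@mulgI _ (f 1)); rewrite -gmulfM !mulg1. Qed.

Lemma multV x : f x^-1 = (f x)^-1.
Proof. by apply: (@mulgI _ (f x)); rewrite -gmulfM !mulgV mult1. Qed.

Lemma mult_wval (X : choiceType) (h : X -> G) w :
  f (wval h w) = wval (f \o h) w.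
Proof.
elim: w => [|[x b] w IH]; first by rewrite !wval_nil mult1.
by rewrite !wval_cons gmulfM IH; case: b => //=; rewrite multV.
Qed.

End Morphisms.

Lemma eq_wval (X : choiceType) (H : groupType) (h k : X -> H) :
  h =1 k -> wval h =1 wval k.
Proof. by move=> hk w; apply: eq_bigr => p _; rewrite hk. Qed.

(** * Presentations as faithfulness of words *)

Section Presented.
Local Open Scope quotient_scope.
Variables (X : choiceType) (rels : set (word X)).

Lemma wval_pgen w : wval (pgen rels) w = \pi_(pres rels) w.
Proof.
elim: w => [|[x b] w IH]; first by rewrite wval_nil.
rewrite wval_cons IH -cat1s -pmulE; congr (_ * _).
case: b => //=; exact: (pinvE rels (wlet x)).
Qed.

Lemma wval_pgen_surj (g : pres rels) : exists w, g = wval (pgen rels) w.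
Proof. by elim/quotW: g => w; exists w; rewrite wval_pgen. Qed.

Lemma wval_pgen_rel r : rels r -> wval (pgen rels) r = 1.
Proof. by move=> relr; rewrite wval_pgen; apply/pres_eqP/weq_rel. Qed.

Variables (H : groupType) (h : X -> H).
Hypothesis h_rels : forall r, rels r -> wval h r = 1.
Hypothesis h_gen : forall g, exists w, g = wval h w.

(** The hypotheses give a surjection from the presented group onto [H], so only its injectivity is
    at stake, and that is a condition on words alone. *)
Lemma presents_iff :
  (exists psi : {multiplicative H -> pres rels},
     bijective psi /\ forall x, psi (h x) = pgen rels x) <->
  (forall w, wval h w = 1 -> wval (pgen rels) w = 1).
Proof.
split=> [[psi [_ psih]] w w1|faithful].
  by rewrite -(eq_wval psih) -[X in wval X]/(psi \o h) -mult_wval w1 mult1.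
have [phi phih] := pres_universal h_rels.
have phiw w : phi (wval (pgen rels) w) = wval h w.
  by rewrite mult_wval; apply: eq_wval.
have phi_inj : injective phi.
  move=> a b /eqP; have [u ->] := wval_pgen_surj a; have [v ->] := wval_pgen_surj b.
  rewrite !phiw -divg_eq1 -wval_winv -wval_cat => /eqP/faithful.
  by rewrite wval_cat wval_winv => /divg1_eq.
have phi_surj g : exists a, phi a = g.
  by have [w ->] := h_gen g; exists (wval (pgen rels) w).
(* The isomorphism is the inverse of [phi]; its multiplicativity follows from the injectivity of
   [phi]. *)
pose psi g := projT1 (cid (phi_surj g)).
have psiK : cancel psi phi by move=> g; rewrite /psi; case: cid.
have phiK : cancel phi psi by move=> a; apply: phi_inj; rewrite psiK.
have psiM : {morph psi : a b / a * b}.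
  by move=> a b; apply: phi_inj; rewrite gmulfM !psiK.
pose M := isMultiplicative.Build _ _ psi psiM.
exists (HB.pack psi M : {multiplicative H -> pres rels}); split=> [|x] /=.
  by exists phi.
by rewrite -phih phiK.
Qed.

End Presented.

(** * Exponent sums and free abelian groups *)

Section FreeAbelian.
Variable L : choiceType.

(** The coordinates of [w] in the abelianization of the free group on [L]. *)
Definition wexp (w : word L) (l : L) : int :=
  \sum_(p <- w | p.1 == l) (if p.2 then 1 else -1)%R.

Section Exponents.
Variables (H : groupType) (z : L -> H).
Hypothesis zC : forall k l, commute (z k) (z l).

(** This is the effect of one letter on an exponent. Since [zexpg] is defined by the sign of the
    exponent, the passages between -1 and 0 are separate cases. *)
Lemma zexpgD1 (g : H) (n : int) (b : bool) :
  zexpg g ((if b then 1 else -1) + n)%R = (if b then g else g^-1) * zexpg g n.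
Proof.
case: b n => [] [n|n].
- by rewrite -[(1 + _)%R]/(Posz n.+1) /= expgS.
- case: n => [|n]; first by rewrite /= mulgV.
  have -> : (1 + Negz n.+1 = Negz n)%R by lia.
  by rewrite /= [g ^+ n.+2]expgSr invgM mulVKg.
- case: n => [|n]; first by rewrite /= mulg1.
  have -> : (-1 + Posz n.+1 = Posz n)%R by lia.
  by rewrite /= expgS mulKg.
- have -> : (-1 + Negz n = Negz n.+1)%R by lia.
  by rewrite /= [g ^+ n.+2]expgSr invgM.
Qed.

Lemma commute_zexpg (g k : H) n : commute g k -> commute g (zexpg k n).
Proof.
by move=> gk; case: n => n /=; [|apply: commuteV]; apply: commuteX.
Qed.

(** Commuting values can be collected generator by generator. The list [s] may be larger than the
    set of letters of [w], so it stays fixed while the word shrinks in the induction. *)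
Lemma wval_wexp (s : seq L) (w : word L) : uniq s ->
  {subset [seq p.1 | p <- w] <= s} ->
  wval z w = \prod_(l <- s) zexpg (z l) (wexp w l).
Proof.
move=> us; elim: w => [|[k b] w IH] sub.
  by rewrite wval_nil big1// => l _; rewrite /wexp big_nil.
rewrite wval_cons IH => [|l ls]; last by apply: sub; rewrite inE ls orbT.
have ks : k \in s by apply: sub; rewrite mem_head.
(* The first letter becomes a product over [s] with one nontrivial factor, to be merged factor by
   factor with the product for the tail. *)
have -> : (if b then z k else (z k)^-1) =
    \prod_(l <- s) (if l == k then if b then z k else (z k)^-1 else 1).
  by rewrite -big_mkcond -big_filter filter_pred1_uniq ?big_seq1.
rewrite -prodgM_commute => [|i j _ _].
  apply: eq_bigr => l _; rewrite /wexp big_cons /= [k == l]eq_sym.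
  by case: eqVneq => [->|_]; rewrite ?mul1g// zexpgD1.
apply: commute_zexpg; case: ifP => _; last exact/commute_sym/commute1.
by case: (b); [exact: zC|apply/commute_sym/commuteV/zC].
Qed.

End Exponents.

Lemma zexpg_wval (H : groupType) (z : L -> H) l n :
  exists w, zexpg (z l) n = wval z w.
Proof.
have pow m : z l ^+ m = wval z (nseq m (l, true)).
  by elim: m => [|m IH]; rewrite ?wval_nil// wval_cons expgS IH.
case: n => m /=; first by eexists; apply: pow.
by exists (winv (nseq m.+1 (l, true))); rewrite wval_winv pow.
Qed.

Variables (H : groupType) (Z : set H) (z : L -> H).
Hypothesis hz : free_abelian_basis Z z.

Lemma free_abelian_wval g : Z g -> exists w, g = wval z w.
Proof.
move=> /(fab_span hz)[s [n ->]]; elim: s => [|l s [w IH]].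
  by exists [::]; rewrite big_nil wval_nil.
have [v E] := zexpg_wval z l (n l).
by exists (v ++ w); rewrite big_cons IH E wval_cat.
Qed.

(* Both values are determined by the exponent sums of [w], which vanish. *)
Lemma free_abelian_wval1 (G : groupType) (y : L -> G) w :
  (forall k l, commute (y k) (y l)) -> wval z w = 1 -> wval y w = 1.
Proof.
move=> yC; pose s := undup [seq p.1 | p <- w].
have sub : {subset [seq p.1 | p <- w] <= s} by move=> l; rewrite mem_undup.
have us : uniq s by apply: undup_uniq.
have zC k l : commute (z k) (z l).
  by apply: (fab_abelian hz); apply: (fab_mem hz).
rewrite !(wval_wexp _ us sub)// => /(fab_free hz us) n0.
by rewrite big_seq big1// => l /n0 ->.
Qed.

End FreeAbelian.

(** * Presentations of a group and of its central extension *)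

Section CentralExtension.
Variables (X L : choiceType) (f : L -> seq X) (W H : groupType).
Variables (h : X -> W) (k : X -> H) (z : L -> H).
Hypothesis h_gen : forall g, exists w, g = wval h w.
Hypothesis k_gen : forall g, exists w, g = wval k w.
Hypothesis hV : forall x, h x * h x = 1.
Hypothesis kV : forall x, k x * k x = 1.
Hypothesis h_f : forall l, wval h (wpos (f l)) = 1.
Hypothesis k_f : forall l, z l = wval k (wpos (f l)).
Hypothesis hz : free_abelian_basis (@center H) z.
Hypothesis k_h : forall w, wval k w = 1 -> wval h w = 1.
Hypothesis h_k : forall w, wval h w = 1 -> center (wval k w).

Let G := pres (weyl_rels f).
Let Gt := pres (hweyl_rels f).
Let x_ : X -> G := pgen (weyl_rels f).
Let xt_ : X -> Gt := pgen (hweyl_rels f).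
Let c l : Gt := wval xt_ (wpos (f l)).

Lemma weyl_rels_wval r : weyl_rels f r -> wval h r = 1.
Proof.
by case=> [[x ->]|[l ->]]; rewrite ?h_f// wval_cat !wval_wlet.
Qed.

Lemma wval_wcomm (K : groupType) (y : X -> K) u v :
  wval y (wcomm u v) = 1 <-> commute (wval y u) (wval y v).
Proof.
rewrite /wcomm !wval_cat !wval_winv /commute !mulgA -mulgA -invgM; split.
  exact: divg1_eq.
by move=> ->; rewrite mulgV.
Qed.

Lemma hweyl_rels_wval r : hweyl_rels f r -> wval k r = 1.
Proof.
case=> [[x ->]|[x [l ->]]]; first by rewrite wval_cat !wval_wlet.
apply/wval_wcomm; rewrite -k_f; exact/commute_sym/(fab_mem hz).
Qed.

(** The commutator relators give commutation with the generators only; it spreads to all of [Gt]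
    because every element is the value of a word. *)
Lemma relators_central l g : commute g (c l).
Proof.
apply/commute_sym; have [w ->] := wval_pgen_surj g; apply: commute_wval => x.
apply/commute_sym; rewrite -/(xt_ x) -(wval_wlet xt_).
by apply/wval_wcomm/wval_pgen_rel; right; exists x, l.
Qed.

(* [G] is the quotient of [Gt] by the subgroup generated by the central
   elements [c l]. *)
Lemma weq_weyl_hweyl u v :
  weq (weyl_rels f) u v -> exists s, wval xt_ u = wval xt_ v * wval c s.
Proof.
have cC s g : commute g (wval c s).
  by apply: commute_wval => l; apply: relators_central.
elim=> {u v} [u|u v _ [s E]|u v w _ [s E] _ [t E']|u u' v v' _ [s E] _ [t E']|x b|r].
- by exists [::]; rewrite wval_nil mulg1.
- by exists (winv s); rewrite wval_winv E mulgK.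
- by exists (t ++ s); rewrite wval_cat E E' mulgA.
(* The central correction of the left half moves past the value of the right half. *)
- exists (s ++ t); rewrite !wval_cat E E' -!mulgA; congr (_ * _).
  by rewrite !mulgA; congr (_ * _); apply/commute_sym/cC.
- exists [::]; rewrite !wval_cons !wval_nil !mulg1.
  by case: b; rewrite /= ?mulgV ?mulVg.
case=> [[x ->]|[l ->]].
  exists [::]; rewrite !wval_nil mulg1; apply: wval_pgen_rel.
  by left; exists x.
by exists (wlet l); rewrite wval_nil wval_wlet mul1g.
Qed.

(** The generators of [G] satisfy the relations of [Gt], a commutator with a trivial element being
    trivial; this yields a morphism from [Gt] to [G]. *)
Lemma hweyl_weyl w : wval xt_ w = 1 -> wval x_ w = 1.
Proof.
have xG r : hweyl_rels f r -> wval x_ r = 1.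
  case=> [[y ->]|[y [l ->]]]; first by apply: wval_pgen_rel; left; exists y.
  apply/wval_wcomm; rewrite (@wval_pgen_rel _ _ (wpos _)); last by right; exists l.
  exact: commute1.
have [phi phix] := pres_universal xG.
move=> w1; rewrite -(eq_wval phix) -[X in wval X]/(phi \o xt_) -mult_wval.
by rewrite w1 mult1.
Qed.

(** Turns a relation among the central elements into one among the generators. *)
Definition wsubst (s : word L) : word X :=
  flatten [seq if p.2 then wpos (f p.1) else winv (wpos (f p.1)) | p <- s].

Lemma wval_wsubst (K : groupType) (y : X -> K) s :
  wval y (wsubst s) = wval (fun l => wval y (wpos (f l))) s.
Proof.
elim: s => [|[l b] s IH]; first by rewrite !wval_nil.
rewrite -[wsubst _]/(_ ++ wsubst s) wval_cat IH wval_cons /=.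
by case: b; rewrite ?wval_winv.
Qed.

Lemma presents_central_extension :
  (exists psi : {multiplicative W -> G},
     bijective psi /\ forall x, psi (h x) = x_ x) <->
  (exists theta : {multiplicative H -> Gt},
     bijective theta /\ forall x, theta (k x) = xt_ x).
Proof.
have zE s : wval z s = wval k (wsubst s).
  by rewrite wval_wsubst; apply: eq_wval => l; rewrite k_f.
split=> [/(presents_iff weyl_rels_wval h_gen)|/(presents_iff hweyl_rels_wval k_gen)] inj.
  apply/(presents_iff hweyl_rels_wval k_gen) => w w1.
  have := inj _ (k_h w1); rewrite wval_pgen => /pres_eqP/weq_weyl_hweyl[s].
  rewrite wval_nil mul1g => E; rewrite -/xt_ E.
  (* In [Gt] the value of [w] is a product of the [c l], recorded by [s]. The morphism from [Gt] to
     [H] sends [c l] to [z l], so [s] has trivial value in the free generators [z l], and freeness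
     kills it in the [c l] as well. *)
  apply: (free_abelian_wval1 hz); first by move=> i j; apply: relators_central.
  have [phi phik] := pres_universal hweyl_rels_wval.
  have phiw u : phi (wval xt_ u) = wval k u.
    by rewrite mult_wval; apply: eq_wval.
  by rewrite zE -phiw wval_wsubst -E phiw.
(* A word trivial in [W] has a central value in [H], hence equals there a word in the [z l].
   Dividing this out leaves a word trivial in [H], therefore in [Gt] and in [G]. *)
apply/(presents_iff weyl_rels_wval h_gen) => w /h_k.
move=> /(free_abelian_wval hz)[s]; rewrite zE => E.
have : wval x_ (w ++ winv (wsubst s)) = 1.
  apply/hweyl_weyl/inj.
  by rewrite wval_cat wval_winv E mulgV.
rewrite wval_cat wval_winv => /divg1_eq ->.
rewrite wval_wsubst; set y := fun _ => _.
(* The factor divided out is a product of relators of [G] and their inverses. *)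
have y1 l : y l = 1 by apply: wval_pgen_rel; right; exists l.
elim: s {E} => [|[l b] s IH]; first by rewrite wval_nil.
by rewrite wval_cons IH y1 mulg1; case: b; rewrite ?invg1.
Qed.

End CentralExtension.

End Words.

(** * Automorphisms, and isometries of the hyperbolic space *)

Lemma lAut_linear (K : nzRingType) (V : lmodType K) (g : lAut V) : linear g.
Proof. exact: (aut_mem g). Qed.

Lemma lAut_subZ (K : nzRingType) (V : lmodType K) (g : lAut V) c x u :
  g (x - c *: u) = g x - c *: g u.
Proof. by rewrite [x - _]addrC -[- _ in LHS]scaleNr lAut_linear scaleNr addrC. Qed.

Lemma lAutZ (K : nzRingType) (V : lmodType K) (g : lAut V) c x :
  g (c *: x) = c *: g x.
Proof.
have g0 : g 0 = 0
  by have := lAut_subZ g 1 0 0; rewrite !scale1r !subrr.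
by rewrite -[c *: x]addr0 lAut_linear g0 addr0.
Qed.

Lemma zAutB (A : zmodType) (g : zAut A) : {morph g : a b / a - b}.
Proof. exact: (aut_mem g). Qed.

Lemma zAutMz (A : zmodType) (g : zAut A) (a : A) n : g (a *~ n) = g a *~ n.
Proof.
pose M := GRing.isZmodMorphism.Build _ _ (g : A -> A) (aut_mem g).
exact: (raddfMz (HB.pack (g : A -> A) M : {additive A -> A})).
Qed.

Section HyperbolicIsometries.
Variables (A : zmodType) (form : psd_form A) (R : set A).
Variable D : A1_decomposition form R.
Variables (J : choiceType) (lam : J -> {linear V0 form -> rat^o}).
Local Notation V := (hypV lam).
Local Notation B := (@formH A form R D J lam).

Lemma formHBl (c : rat) (x u y : V) : B (x - c *: u) y = B x y - c * B u y.
Proof. by rewrite addrC -scaleNr formH_linear mulNr addrC. Qed.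

Lemma formHBr (c : rat) (x u y : V) : B y (x - c *: u) = B y x - c * B y u.
Proof. by rewrite formHC formHBl !(formHC D _ y). Qed.

Lemma hrefl_isometry (a : ratext A) (x y : V) :
  B (hrefl D lam a x) (hrefl D lam a y) = B x y.
Proof.
rewrite /= /hrefl_fun; set u : V := (a, 0).
rewrite !(formHBl, formHBr) (formHC D u y) /cpair.
case: ifPn => [u0|_]; last by rewrite !mul0r !subr0.
by field.
Qed.

Definition hyp_isometry : {pred lAut V} :=
  [pred g : lAut V | `[< forall x y, B (g x) (g y) = B x y >]].

Lemma hyp_isometry_closed : group_closed hyp_isometry.
Proof.
split=> [|g h /asboolP gB /asboolP hB]; first exact/asboolP.
have hK x : h ((h^-1)%g x) = x by exact: autVK.
by apply/asboolP => x y; apply: etrans (gB _ _) _; rewrite -hB !hK.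
Qed.

Lemma hrefl_hyp_isometry a : hrefl D lam a \in hyp_isometry.
Proof. by apply/asboolP; apply: hrefl_isometry. Qed.

(** An isometry preserves the pairing with coroots, so it transports the reflection in a vector to
    the reflection in its image. *)
Lemma hrefl_conj (g : lAut V) (u v : ratext A) : g \in hyp_isometry ->
  g ((u, 0) : V) = (v, 0) -> hrefl D lam v = (g * hrefl D lam u * g^-1)%g.
Proof.
move=> /asboolP gB guv; apply: (@mulIg _ g); rewrite mulgVK.
apply: autP => x.
rewrite -[LHS]/(hrefl_fun D v (g x)) -[RHS]/(g (hrefl_fun D u x)).
by rewrite /hrefl_fun lAut_subZ guv -guv /cpair !gB.
Qed.

(** Since [A] spans [V] over the rationals, [g] fixes every [a] in [V], and conjugation by [g] then
    fixes the reflection in [a]. Nothing is asked of [g] outside [V]. *)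
Lemma hyp_isometry_central (g : lAut V) : g \in hyp_isometry ->
  (forall b, g ((ratinj b, 0) : V) = (ratinj b, 0)) ->
  forall a, commute g (hrefl D lam a).
Proof.
move=> isog gfix a.
have gV (v : ratext A) : g ((v, 0) : V) = (v, 0).
  elim/ratfracW: v => b n n0; rewrite ratfracE//.
  have -> : ((n%:R^-1 *: ratinj b, 0) : V) = n%:R^-1 *: ((ratinj b, 0) : V).
    by congr pair; rewrite scaler0.
  by rewrite lAutZ gfix.
by rewrite /commute [in RHS](hrefl_conj isog (gV a)) mulgVK.
Qed.

End HyperbolicIsometries.

(** * From the hyperbolic Weyl group to the Weyl group *)

Lemma gen_pred_wval (X : choiceType) (G : groupType) (h : X -> G) (S : set G) :
  (forall x, S x -> exists w, x = wval h w) ->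
  forall g, g \in gen_pred S -> exists w, g = wval h w.
Proof.
move=> Sh g /asboolP gS.
pose K : {pred G} := [pred g | `[< exists w, g = wval h w >]].
suff /asboolP : g \in K by [].
apply: gS => [|x /Sh]; last by move=> ?; apply/asboolP.
split=> [|x y /asboolP[u ->] /asboolP[v ->]]; apply/asboolP.
  by exists [::]; rewrite wval_nil.
by exists (u ++ winv v); rewrite wval_cat wval_winv.
Qed.

Lemma gen_group_wval (X : choiceType) (G : groupType) (S : set G)
    (k : X -> gen_group S) (h : X -> G) :
  (forall x, gen_val (k x) = h x) -> forall w, gen_val (wval k w) = wval h w.
Proof.
move=> kh w; rewrite -(eq_wval kh).
exact: (mult_wval (val : {multiplicative _ -> _})).
Qed.

Section Reflections.
Variables (A : zmodType) (form : psd_form A) (R : set A).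
Hypothesis hA : torsion_free A.
Hypothesis hR : affine_reflection_system form R.
Variable D : A1_decomposition form R.
Variables (J : choiceType) (lam : J -> {linear V0 form -> rat^o}).
Variables (Pi : set A) (hPi : reflectable form R Pi).
Local Notation V := (hypV lam).

Lemma Pi_root (a : Pi) : R (val a).
Proof. exact: reflectable_sub hPi _ (set_valP a). Qed.

Definition reflPi (a : Pi) : zAut A := refl form (val a).
Definition hreflPi (a : Pi) : lAut V := hrefl D lam (ratinj (val a)).

(** Plays the role of restriction from the hyperbolic space to [A]. Being a relation, it needs no
    prior proof that [g] preserves [A]. *)
Definition lifts (h : zAut A) (g : lAut V) :=
  forall b, g ((ratinj b, 0) : V) = (ratinj (h b), 0).

Lemma lifts1 : lifts 1%g 1%g. Proof. by []. Qed.

Lemma liftsM h g h' g' : lifts h g -> lifts h' g' -> lifts (h * h')%g (g * g')%g.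
Proof. by move=> hg hg' b; rewrite -[LHS]/(g (g' _)) hg' hg. Qed.

Lemma liftsV h g : lifts h g -> lifts h^-1%g g^-1%g.
Proof.
move=> hg b; have hK : h ((h^-1)%g b) = b by exact: autVK.
by rewrite -[in LHS]hK -hg; apply: autK.
Qed.

(** Torsion-freeness enters here: it makes [A] embed in its rational extension, so [g] determines
    its restriction. *)
Lemma lifts_inj h h' g : lifts h g -> lifts h' g -> h = h'.
Proof.
move=> hg hg'; apply: autP => b; apply: (@ratinj_inj A hA).
by have := hg b; rewrite hg' => -[].
Qed.

Lemma lifts_refl a : R a -> lifts (refl form a) (hrefl D lam (ratinj a)).
Proof.
move=> Ra b; have [n nE ->] := reflE b hR Ra.
rewrite /= /hrefl_fun.
have -> : cpair (@formH _ _ _ D _ lam) (ratinj b, 0) (ratinj a, 0) = n%:~R.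
  by rewrite nE /cpair !formH_V !formV_ratinj.
congr pair; last by rewrite /= scaler0 subr0.
by rewrite /= [RHS]raddfB raddfMz scaler_int.
Qed.

Lemma lifts_wval w : lifts (wval reflPi w) (wval hreflPi w).
Proof.
elim: w => [|[a b] w IH]; first by rewrite !wval_nil; apply: lifts1.
have ra := lifts_refl (Pi_root a).
rewrite !wval_cons; apply: liftsM => //.
by case: b => //=; apply: liftsV.
Qed.

Lemma wval_hyp_isometry w : wval hreflPi w \in @hyp_isometry _ _ _ D _ lam.
Proof.
apply: wval_ind; first exact: hyp_isometry_closed.
by move=> a; apply: hrefl_hyp_isometry.
Qed.

Lemma hrefl_radical a : radical form a -> hrefl D lam (ratinj a) = 1%g.
Proof.
move=> rad; apply: autP => x; rewrite /= /hrefl_fun /cpair formH_V formV_ratinj.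
by rewrite rad eqxx scale0r subr0.
Qed.

Lemma hrefl_wval a : R a -> exists w, hrefl D lam (ratinj a) = wval hreflPi w.
Proof.
move=> Ra; have [rad|nrad] := pselect (radical form a).
  (* An isotropic root has zero coroot pairing by convention, so its reflection is the identity. *)
  by exists [::]; rewrite hrefl_radical// wval_nil.
have : nonisotropic form R a by [].
(* Reflectability moves some [b] in [Pi] to [a] by an element of the group generated by [Pi]; a word
   for that element, evaluated hyperbolically, conjugates the reflection in [b] to the one in
   [a]. *)
case: (hPi) => _ <- [] g _ [b Pb] <-.
have [|w E] := @gen_pred_wval _ _ reflPi (refl form @` Pi) _ (gen_val g) (gen_valP g).
  by move=> _ [c Pc <-]; exists (wlet (exist _ c (mem_set Pc))); rewrite wval_wlet.
pose b' : Pi := exist _ b (mem_set Pb).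
exists (w ++ wlet b' ++ winv w); rewrite !wval_cat wval_winv wval_wlet mulgA.
apply: hrefl_conj; first exact: wval_hyp_isometry.
by rewrite E; apply: lifts_wval.
Qed.

Lemma refl_wval a : R a -> exists w, refl form a = wval reflPi w.
Proof.
move=> Ra; have [w E] := hrefl_wval Ra; exists w.
by apply: (lifts_inj (lifts_refl Ra)); rewrite E; apply: lifts_wval.
Qed.

(** Restricted from the hyperbolic space, where the reflection is an involution. *)
Lemma reflK a : R a -> (refl form a * refl form a = 1)%g.
Proof.
move=> Ra; apply: (lifts_inj (liftsM (lifts_refl Ra) (lifts_refl Ra))).
suff -> : (hrefl D lam (ratinj a) * hrefl D lam (ratinj a) = 1)%g by [].
by apply: autP => x; apply: hreflK.
Qed.

Lemma wval_central w : wval reflPi w = 1%g ->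
  forall a, commute (wval hreflPi w) (hrefl D lam a).
Proof.
move=> w1; apply: hyp_isometry_central; first exact: wval_hyp_isometry.
by move=> b; rewrite lifts_wval w1.
Qed.

End Reflections.

(** * Alternating products in the Weyl group *)

Section AlternatingWords.
Variables (A : zmodType) (form : psd_form A) (R : set A).
Hypothesis hR : affine_reflection_system form R.
Variable D : A1_decomposition form R.
Variables (Pi : set A) (hPi : reflectable form R Pi).
Local Notation ep := (eps D).

Lemma refl_fix_radical a s : R a -> radical form s -> refl form a s = s.
Proof.
move=> Ra rs; have [n nE ->] := reflE s hR Ra.
suff -> : n = 0 by rewrite mulr0z subr0.
apply: (@intr_inj rat); rewrite nE /cpair rs mulr0 mul0r.
by case: ifP.
Qed.

Lemma sgnA_root a : nonisotropic form R a -> sgnA D a = 1 \/ sgnA D a = -1.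
Proof.
move=> [Ra nrad]; have rS s : isoS D s -> radical form s by case/(isoS_sub).
(* The coefficient of [eps] is unique because no nonzero multiple of [eps] is radical. *)
have sgnE (n : int) : radical form (a - ep *~ n) -> sgnA D a = n.
  move=> an; apply/eqP; rewrite -subr_eq0; apply/eqP; apply: (@A1_direct _ _ _ D).
  have -> : ep *~ (sgnA D a - n) = (a - ep *~ n) - pA D a.
    by rewrite /pA mulrzBr opprB [RHS]addrC addrA subrK.
  exact/radicalB/pA_radical.
have [] : ([set a + b | a in isoS D & b in isoS D] `|`
    [set a + b | a in [set 0; ep; - ep] & b in isoS D]) a by rewrite -(A1_roots D).
  move=> [s Ss [t St E]].
  by case: nrad; rewrite -E; apply: radicalD; apply: rS.
move=> [e ed [s Ss E]].
case: ed => [[e0|e1]|e2].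
- by case: nrad; rewrite -E e0 add0r; apply: rS.
- by left; apply: sgnE; rewrite -E e1 mulr1z addrAC subrr add0r; apply: rS.
- by right; apply: sgnE; rewrite -E e2 mulrN1z opprK addrAC addNr add0r; apply: rS.
Qed.

(** Since the sign of a nonisotropic root squares to 1, (a, a) = 2 and the pairing of [eps] with the
    coroot of [a] is twice that sign. *)
Lemma refl_eps a : nonisotropic form R a ->
  refl form a ep = - ep - pA D a *~ (2 * sgnA D a).
Proof.
move=> na; have [Ra _] := na; have [n nE ->] := reflE ep hR Ra.
have aE : a = ep *~ sgnA D a + pA D a by rewrite /pA addrC subrK.
have s2 : sgnA D a * sgnA D a = 1 by case: (sgnA_root na) => ->.
have ea : form ep a = 2 * (sgnA D a)%:~R.
  rewrite Defs.formC [X in form X _]aE Defs.formDl formMzl pA_radical addr0.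
  by rewrite A1_norm mulrC.
have aa : form a a = 2.
  rewrite [X in form X _]aE Defs.formDl formMzl pA_radical addr0 ea mulrCA.
  by rewrite -intrM s2 mulr1.
have -> : n = 2 * sgnA D a.
  apply: (@intr_inj rat).
  by rewrite nE /cpair aa ea pnatr_eq0 /= intrM mulrC mulKf.
have -> : a *~ (2 * sgnA D a) = ep *~ 2 + pA D a *~ (2 * sgnA D a).
  by rewrite [X in X *~ _]aE mulrzDl -mulrzA mulrCA s2 mulr1.
by rewrite opprD addrA -[ep *~ 2]/(ep *+ 2) mulr2n opprD addrA subrr sub0r.
Qed.

(** The sum in [Alt], kept in the same form so that membership in [Alt] rewrites it directly. *)
Definition alt_sum (s : seq Pi) : A :=
  \sum_(j < size s) (let a := val (tnth (in_tuple s) j) in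
    pA D a *~ ((-1) ^+ j.+1 * sgnA D a)).

(** A new head shifts every later index by one, which flips the sign of the tail. *)
Lemma alt_sum_cons a s :
  alt_sum (a :: s) = - (pA D (val a) *~ sgnA D (val a)) - alt_sum s.
Proof.
rewrite /alt_sum big_ord_recl /= expr1 mulN1r mulrNz; congr (_ + _).
rewrite -sumrN; apply: eq_bigr => j _; rewrite -mulrNz exprS mulN1r mulNr.
by rewrite !(tnth_nth a).
Qed.

Lemma radical_alt_sum s : radical form (alt_sum s).
Proof.
elim: s => [|a s IH]; first by rewrite /alt_sum big_ord0; apply: radical0.
rewrite alt_sum_cons; apply: radicalB => //.
by rewrite -mulrNz; apply/radicalMz/pA_radical.
Qed.

Let PiR (a : Pi) : nonisotropic form R (val a).
Proof. by case: hPi => sub _; apply/sub/set_valP. Qed.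

Local Notation wvalW := (wval (reflPi form (Pi := Pi))).

Lemma wval_reflPi_radical (s : seq Pi) t :
  radical form t -> wvalW (wpos s) t = t.
Proof.
move=> rt; elim: s => [|a s IH]; first by rewrite wval_nil.
rewrite wval_cons -[LHS]/(reflPi form a (wvalW (wpos s) t)) IH.
exact: (refl_fix_radical (PiR a).1).
Qed.

(** Each reflection negates [eps] up to a radical term and fixes the radical. The signs accumulate
    to the parity of the word, the radical terms to twice the alternating sum. *)
Lemma wval_reflPi_eps (s : seq Pi) : wvalW (wpos s) ep =
  (ep - alt_sum s *+ 2) *~ (-1) ^+ size s.
Proof.
elim: s => [|a s IH].
  by rewrite wval_nil /alt_sum big_ord0 mul0rn subr0 mulr1z.
rewrite wval_cons -[LHS]/(refl form (val a) (wvalW (wpos s) ep)) IH zAutMz zAutB.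
rewrite (refl_eps (PiR a)) (refl_fix_radical (PiR a).1); last first.
  exact/radicalMn/radical_alt_sum.
rewrite exprS mulN1r mulrNz -[RHS]mulNrz; congr (_ *~ _).
rewrite alt_sum_cons [2 * _]mulrC mulrzA -[_ *~ 2]/(_ *+ 2).
rewrite -[- _ - alt_sum s]opprD mulNrn opprK mulrnDl.
by rewrite !opprD !addrA.
Qed.

Lemma Alt_wval (s : seq Pi) :
  Alt D s -> wvalW (wpos s) = 1%g.
Proof.
move=> [even_s alt0]; apply: autP => b.
(* It suffices to treat [eps] and the radical, which together generate [A]. The difference form
   suits [zAutB]. *)
have bE : b = ep *~ sgnA D b - (- pA D b) by rewrite opprK /pA addrC subrK.
rewrite [in LHS]bE zAutB zAutMz wval_reflPi_eps wval_reflPi_radical; last first.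
  by rewrite -[- _]add0r; apply: radicalB; [exact: radical0|exact: pA_radical].
rewrite [alt_sum s]alt0 mul0rn subr0 -signr_odd (negbTE even_s) mulr1z.
by rewrite -bE.
Qed.

End AlternatingWords.

Theorem theorem3p12 (A : zmodType) (form : psd_form A) (R : set A)
    (hA : torsion_free A)
    (hR : affine_reflection_system form R)
    (hirr : irreducible_ars form R)
    (htame : tame_ars form R)
    (htype : type_A1 form R)
    (D : A1_decomposition form R)
    (J : choiceType) (sigma : J -> V0 form)
    (hsigmaS : forall j, exists2 s, isoS D s & val (sigma j) = ratinj s)
    (hsigma : is_basis sigma)
    (lam : J -> {linear V0 form -> rat^o})
    (hlam : forall i j, lam j (sigma i) = (i == j)%:R)
    (Pi : set A) (hPi : reflectable form R Pi)
    (L : choiceType) (z : L -> hweyl D lam)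
    (hz : free_abelian_basis (@center (hweyl D lam)) z)
    (f : L -> seq Pi) (hf : forall l, Alt D (f l))
    (hzf : forall l, z l =
       (\prod_(a <- f l) hweyl_refl D lam (set_incl (reflectable_sub hPi) a))%g) :
  (exists psi : {multiplicative weyl form R -> pres (weyl_rels f)},
     bijective psi /\
     forall a : Pi,
       psi (weyl_refl form (set_incl (reflectable_sub hPi) a)) = pgen _ a)
  <->
  (exists theta : {multiplicative hweyl D lam -> pres (hweyl_rels f)},
     bijective theta /\
     forall a : Pi,
       theta (hweyl_refl D lam (set_incl (reflectable_sub hPi) a)) = pgen _ a).
Proof.
pose incl := set_incl (reflectable_sub hPi).
pose hW a := weyl_refl form (incl a); pose hH a := hweyl_refl D lam (incl a).
(* The two groups are generated by all of [R], while words use only [Pi]; equalities are checked in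
   the ambient automorphism groups. *)
have hWE : forall w, gen_val (wval hW w) = wval (reflPi form (Pi := Pi)) w.
  exact: gen_group_wval.
have hHE : forall w, gen_val (wval hH w) = wval (hreflPi D lam (Pi := Pi)) w.
  exact: gen_group_wval.
have liftsE w := lifts_wval hR D lam hPi w.
have genW (g : weyl form R) : exists w, g = wval hW w.
  have [|w E] := @gen_pred_wval _ _ (reflPi form (Pi := Pi)) _ _ _ (gen_valP g).
    by move=> _ [a Ra <-]; apply: (refl_wval hA hR D lam hPi).
  by exists w; apply: val_inj; rewrite /= hWE E.
have genH (g : hweyl D lam) : exists w, g = wval hH w.
  have [|w E] := @gen_pred_wval _ _ (hreflPi D lam (Pi := Pi)) _ _ _ (gen_valP g).
    by move=> _ [a Ra <-]; apply: (hrefl_wval hR D lam hPi).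
  by exists w; apply: val_inj; rewrite /= hHE E.
apply: (@presents_central_extension _ _ f _ _ hW hH z) => //.
- move=> a; apply: val_inj.
  exact: (reflK hA hR D lam (Pi_root hPi a)).
- move=> a; apply: val_inj; apply: autP => x; exact: hreflK.
- by move=> l; apply: val_inj; rewrite /= hWE (Alt_wval hR hPi (hf l)).
- by move=> l; rewrite hzf wval_wpos.
(* A word trivial on the hyperbolic space restricts to the identity of [A]. *)
- move=> w w1; apply: val_inj; rewrite /= hWE.
  by apply: (lifts_inj hA (liftsE w)); rewrite -hHE w1; apply: lifts1.
(* Centrality of the kernel: commuting with the reflections from [Pi] is enough, as they
   generate. *)
- move=> w w1 g; have [v ->] := genH g; apply: commute_wval => a; apply: val_inj.
  have {}w1 : wval (reflPi form (Pi := Pi)) w = 1%g by rewrite -hWE w1.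
  have := wval_central hR D lam hPi w1 (ratinj (val a)).
  by rewrite -hHE.
Qed.
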